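(* Let $\mathcal{C}$ be a clutter with vertex set $V(\mathcal{C})=\{x_1,\ldots,x_n\}$, $n\ge 1$, and let $I=I(\mathcal{C})\subset R=K[x_1,\ldots,x_n]$ be its edge ideal. Then the following hold. (i) If $x_i\in V(\mathcal{C})$ and $\{x_i\}\notin E(\mathcal{C})$, then $\mathrm{v}(I)\le \mathrm{v}(I:x_i)+1$. (ii) If $I\neq\langle x_1,\ldots,x_n\rangle$, then $\mathrm{v}(I:x_i)\le \mathrm{v}(I)$ for some $x_i\in V(\mathcal{C})$. (iii) If $\mathrm{v}(I)\ge 2$, then $\mathrm{v}(I:x_i)<\mathrm{v}(I)$ for some $x_i\in V(\mathcal{C})$. (iv) $\mathrm{v}(I(\mathcal{C}\setminus\{x_i\}))\le \mathrm{v}(I(\mathcal{C}))$ for some $x_i\in V(\mathcal{C})$.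
   Context: $K$ is a field and $R=K[x_1,\ldots,x_n]$ has the standard grading, with $R_d$ its degree-$d$ component. A clutter $\mathcal{C}$ is a pair $(V(\mathcal{C}),E(\mathcal{C}))$ where $V(\mathcal{C})$ is a finite set and $E(\mathcal{C})$ is a collection of nonempty subsets (edges) of $V(\mathcal{C})$, none of which contains another. Its edge ideal is $I(\mathcal{C})=\langle \prod_{x\in e}x : e\in E(\mathcal{C})\rangle$. The clutter $\mathcal{C}\setminus\{x_i\}$ has vertex set $V(\mathcal{C})\setminus\{x_i\}$ and edge set $\{e\in E(\mathcal{C}): x_i\notin e\}$; its edge ideal is taken in the polynomial ring on its vertex set. For a proper graded ideal $I$ of a polynomial ring $R$, its v-number is $\mathrm{v}(I)=\min\{d\ge 0 : \exists f\in R_d \text{ and } \mathfrak{p}\in\mathrm{Ass}(R/I)\text{ with } (I:f)=\mathfrak{p}\}$. *)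

(* Defs.v *)
From mathcomp Require Import all_boot all_order all_algebra.
From mathcomp Require Import boolp.
From mathcomp Require Import mpoly.

Set Implicit Arguments.
Unset Strict Implicit.
Unset Printing Implicit Defensive.

Import GRing.Theory.
Local Open Scope ring_scope.

(** A clutter with vertex set {x_1, ..., x_n}, represented by ['I_n]. *)
Record clutter (n : nat) := Clutter {
  edges : {set {set 'I_n}};
  edges_neq0 : set0 \notin edges;
  edges_antichain : {in edges &, forall e f : {set 'I_n}, e \subset f -> e = f} }.

Section Deletion.
Variables (n : nat) (C : clutter n) (i : 'I_n).

(** [lift i : 'I_n.-1 -> 'I_n] is the increasing bijection onto the vertices
    other than [i]; the vertices of [C \ {x_i}] are named through it. *)
Definition del_edges : {set {set 'I_n.-1}} :=
  [set lift i @^-1: (e : {set 'I_n}) | e in [set e in edges C | i \notin e]].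

Let del_imset (e : {set 'I_n}) : i \notin e -> lift i @: (lift i @^-1: e) = e.
Proof.
move=> ie; apply/setP=> x; apply/imsetP/idP => [[y]|xe].
  by rewrite inE => ye ->.
case: (unliftP i x) => [y Dx|Dx]; last by rewrite -Dx xe in ie.
by exists y; rewrite // inE -Dx.
Qed.

Lemma del_edges_neq0 : set0 \notin del_edges.
Proof.
apply/negP => /imsetP[e]; rewrite inE => /andP[eC ie] De.
by have := edges_neq0 C; rewrite -(imset0 (lift i)) De del_imset ?eC.
Qed.

Lemma del_edges_antichain :
  {in del_edges &, forall e f : {set 'I_n.-1}, e \subset f -> e = f}.
Proof.
move=> _ _ /imsetP[e + ->] /imsetP[f + ->]; rewrite !inE.
move=> /andP[eC ie] /andP[fC jf] /(imsetS (lift i)).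
by rewrite !del_imset // => /(edges_antichain eC fC) ->.
Qed.

Definition clutter_del : clutter n.-1 :=
  Clutter del_edges_neq0 del_edges_antichain.

End Deletion.

Section Ideals.
Variable R : comNzRingType.

(** The ideal generated by the [F t] for [t \in A]. *)
Definition ideal_span (T : finType) (A : {set T}) (F : T -> R) : {pred R} :=
  [pred p | `[< exists c : T -> R, p = \sum_(t in A) c t * F t >]].

Definition colon (I : {pred R}) (f : R) : {pred R} := [pred g | g * f \in I].

(** [p \in Ass(R/I)]: a prime ideal that is the annihilator of a class
    [g + I] of [R/I], i.e. of the form [(I : g)]. [idealr_closed] includes
    [1 \notin p]. *)
Definition associated_prime (I p : {pred R}) : Prop :=
  [/\ idealr_closed p, prime_idealr_closed p & exists g : R, colon I g =i p].

End Ideals.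

Section VNumber.
Variables (K : fieldType) (n : nat).
Implicit Types I : {pred {mpoly K[n]}}.

Definition vnumber_cond I (d : nat) : Prop :=
  exists (f : {mpoly K[n]}) (p : {pred {mpoly K[n]}}),
    [/\ f \is d.-homog, associated_prime I p & colon I f =i p].

(** The least [d] satisfying [vnumber_cond I]. Such a [d] exists for every
    proper graded ideal; the value [0] otherwise is a dummy, taken in
    particular at the unit ideal. *)
Definition vnumber I : nat :=
  match pselect (exists d, `[< vnumber_cond I d >]) with
  | left exd => ex_minn exd
  | right _ => 0%N
  end.

Definition edge_ideal (C : clutter n) : {pred {mpoly K[n]}} :=
  ideal_span (edges C) (fun e => \prod_(x in e) 'X_x).

Definition irrelevant_ideal : {pred {mpoly K[n]}} :=
  ideal_span [set: 'I_n] (fun x => 'X_x).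

End VNumber.

Arguments edge_ideal K [n] C.
Arguments irrelevant_ideal K n : clear implicits.

(* Main.v *)
Require Import Defs.
From HB Require Import structures.
From mathcomp Require Import all_boot all_order all_algebra.
From mathcomp Require Import boolp.
From mathcomp Require Import mpoly.

Set Implicit Arguments.
Unset Strict Implicit.
Unset Printing Implicit Defensive.

Import GRing.Theory.
Local Open Scope ring_scope.

(** The v-number of an edge ideal [I] is a combinatorial quantity, and all four
    claims follow by moving one vertex in or out of a set. Call a set of
    vertices stable if it contains no edge. Whether a monomial lies in [I]
    depends only on the set [A] of variables dividing it: it does exactly when
    [A] is not stable. Say that [A] isolates [S] if every vertex of [S] makes
    [A] unstable when it is added, while all vertices outside [S] can be added
    together without creating an edge. For a monomial [m] with variables [A]
    this means that [(I : m)] is the ideal generated by the variables in [S]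
    ([colon_isolates]), which is prime.

    Conversely, if [f] is homogeneous of degree [d] and [p = (I : f)] is prime,
    let [S] be the set of the variables in [p]. The product of the variables
    outside [S] is not in [p], so its product with some monomial [m] of [f] is
    not in [I]; the variables of this [m] isolate [S] ([cond_isolates]). Hence
    v(I) is the least degree of a monomial whose variables isolate some set. It
    is attained, because a maximal stable set isolates its complement
    ([vnumber_isolates]).

    Now fix [m] of degree v(I) whose set [A] of variables isolates [S].
    - (i) If [(I : x_i) : f] is prime then so is [I : (x_i f)], which is the
      same ideal; and v(I : x_i) is attained because [x_i] is in a maximal
      stable set.
    - (ii) If some [x_i] is outside [S], then [x_i m] still isolates [S], so [m]
      is a witness for [(I : x_i)]. If [S] contains every vertex, then [A] is
      empty, every singleton is an edge and [I] is the irrelevant ideal.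
    - (iii) If [x_i] divides [m], then [m / x_i] is a witness for [(I : x_i)].
    - (iv) If [x_i] is outside [A], then its deletion keeps every edge made of
      vertices of [A] and one other vertex of [S], so that [A] isolates [S]
      minus [x_i] in the smaller clutter.
      If [A] contains every vertex, stability of [A] says that there is no
      edge, and both v-numbers are zero. *)

(** * Ideals spanned by a finite family *)

Section IdealSpan.
Variables (R : comNzRingType) (T : finType) (A : {set T}) (F : T -> R).
Local Notation J := (ideal_span A F).

Lemma ideal_span0 : 0 \in J.
Proof.
by apply/asboolP; exists (fun=> 0); rewrite big1 // => t _; rewrite mul0r.
Qed.

Lemma ideal_spanD u v : u \in J -> v \in J -> u + v \in J.
Proof.
move=> /asboolP[c ->] /asboolP[d ->]; apply/asboolP; exists (fun t => c t + d t).
by rewrite -big_split; apply: eq_bigr => t _; rewrite mulrDl.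
Qed.

Lemma ideal_spanM a u : u \in J -> a * u \in J.
Proof.
move=> /asboolP[c ->]; apply/asboolP; exists (fun t => a * c t).
by rewrite mulr_sumr; apply: eq_bigr => t _; rewrite mulrA.
Qed.

Lemma ideal_span_sum (I : Type) (r : seq I) (P : pred I) (G : I -> R) :
  (forall i, P i -> G i \in J) -> \sum_(i <- r | P i) G i \in J.
Proof.
move=> GJ; apply: (big_ind (fun u => u \in J)) => //; first exact: ideal_span0.
exact: ideal_spanD.
Qed.

Lemma mem_ideal_span t : t \in A -> F t \in J.
Proof.
move=> tA; apply/asboolP; exists (fun s => (s == t)%:R).
rewrite (bigD1 t) //= eqxx mul1r big1 ?addr0 // => s /andP[_ /negbTE->].
by rewrite mul0r.
Qed.

End IdealSpan.

Lemma ideal_span_sub (R : comNzRingType) (T U : finType) (A : {set T})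
    (B : {set U}) (F : T -> R) (G : U -> R) :
    (forall t, t \in A -> F t \in ideal_span B G) ->
  {subset ideal_span A F <= ideal_span B G}.
Proof.
move=> FB _ /asboolP[c ->]; apply: ideal_span_sum => t /FB.
exact: ideal_spanM.
Qed.

Lemma mem_colon (R : comNzRingType) (I : {pred R}) (f g : R) :
  (g \in colon I f) = (g * f \in I).
Proof. by []. Qed.

Lemma colon_colon (R : comNzRingType) (I : {pred R}) (f g : R) :
  colon (colon I f) g =i colon I (g * f).
Proof. by move=> h; rewrite !mem_colon mulrA. Qed.

(** * Variables of a monomial *)

Section Monomials.
Variable n : nat.
Implicit Types (m : 'X_{1..n}) (A : {set 'I_n}).

Definition vars m : {set 'I_n} := [set i | m i != 0%N].

Definition set_mnm A : 'X_{1..n} := [multinom (i \in A : nat) | i < n].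

Lemma vars_set_mnm A : vars (set_mnm A) = A.
Proof. by apply/setP => i; rewrite inE mnmE eqb0 negbK. Qed.

Lemma varsD m1 m2 : vars (m1 + m2) = vars m1 :|: vars m2.
Proof. by apply/setP => i; rewrite !inE mnmDE addn_eq0 negb_and. Qed.

Lemma varsU i : vars U_(i) = [set i].
Proof. by apply/setP => j; rewrite !inE mnm1E eqb0 negbK eq_sym. Qed.

Lemma set_mnm_le A m : A \subset vars m -> (set_mnm A <= m)%MM.
Proof.
move=> /subsetP Am; apply/mnm_lepP => i; rewrite mnmE.
by case: (boolP (i \in A)) => // /Am; rewrite inE lt0n.
Qed.

Lemma mpolyX_set (R : nzRingType) A :
  'X_[set_mnm A] = \prod_(x in A) 'X_x :> {mpoly R[n]}.
Proof.
rewrite mprodXE; congr 'X_[_]; apply/mnmP => i; rewrite mnmE mnm_sumE.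
case: (boolP (i \in A)) => iA.
  rewrite (bigD1 i) //= mnm1E eqxx big1 // => j /andP[_ /negbTE ji].
  by rewrite mnm1E ji.
rewrite big1 // => j jA; rewrite mnm1E; apply/eqP; rewrite eqb0.
by apply: contraNneq iA => <-.
Qed.

End Monomials.

(** * Primes generated by variables *)

Section Primes.
Variables (K : fieldType) (n : nat).
Implicit Types (S : {set 'I_n}) (g : {mpoly K[n]}).

Definition kill S : {mpoly K[n]} -> {mpoly K[n]} :=
  comp_mpoly [tuple if i \in S then 0 else 'X_i | i < n].

HB.instance Definition _ S := GRing.RMorphism.on (kill S).

(** The ideal generated by the variables in [S]. As the kernel of a ring
    morphism into an integral domain it is visibly a prime ideal;
    [mem_var_ideal] gives the description by monomials. *)
Definition var_ideal S : {pred {mpoly K[n]}} := [pred g | kill S g == 0].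

Lemma var_ideal_closed S : idealr_closed (var_ideal S).
Proof.
split; rewrite ?inE ?rmorph0 ?rmorph1 ?oner_eq0 //= => a u v.
by rewrite !inE rmorphD rmorphM /= => /eqP-> /eqP->; rewrite mulr0 addr0.
Qed.

Lemma var_ideal_prime S : prime_idealr_closed (var_ideal S).
Proof. by move=> u v; rewrite !inE rmorphM /= mulf_eq0. Qed.

Lemma kill_mpolyX S m :
  kill S 'X_[m] = if vars m \subset ~: S then 'X_[m] else 0.
Proof.
rewrite /kill comp_mpolyX; case: ifPn => [/subsetP mS|/subsetPn[i]].
  rewrite [RHS]mpolyXE_id; apply: eq_bigr => i _; rewrite tnth_mktuple.
  case: (eqVneq (m i) 0%N) (mS i) => [->|mi]; first by rewrite !expr0.
  by rewrite !inE mi => /(_ isT)/negbTE->.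
rewrite !inE negbK => mi iS; rewrite (bigD1 i) //= tnth_mktuple iS expr0n.
by rewrite (negbTE mi) mul0r.
Qed.

Lemma mcoeff_kill S g m :
  (kill S g)@_m = if vars m \subset ~: S then g@_m else 0.
Proof.
rewrite {1}[g]mpolyE (raddf_sum (kill S)) (raddf_sum (mcoeff m)) /=.
under eq_bigr => u _ do
  rewrite -mul_mpolyC rmorphM /= {1}/kill comp_mpolyC mul_mpolyC mcoeffZ
    kill_mpolyX.
have [mg|mg] := boolP (m \in msupp g); last first.
  rewrite (memN_msupp_eq0 mg) if_same big_seq big1 // => u ug.
  case: ifP; rewrite ?mcoeff0 ?mulr0 // mcoeffX => _.
  by rewrite (_ : u == m = false) ?mulr0 //; apply: contraNF mg => /eqP<-.
rewrite (bigD1_seq m) //= ?msupp_uniq // big1 => [|u /negbTE um].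
  by rewrite addr0; case: ifP; rewrite ?mcoeff0 ?mulr0 // mcoeffX eqxx mulr1.
by case: ifP; rewrite ?mcoeff0 ?mulr0 // mcoeffX um mulr0.
Qed.

Lemma mem_var_ideal S g :
  (g \in var_ideal S) = all (fun m => ~~ (vars m \subset ~: S)) (msupp g).
Proof.
rewrite inE; apply/eqP/allP => [g0 m|gS].
  rewrite mcoeff_msupp; apply: contraNN => mS.
  by have := mcoeff_kill S g m; rewrite mS g0 mcoeff0 => <-.
apply/mpolyP => m; rewrite mcoeff0 mcoeff_kill; case: ifP => // mS.
by apply: memN_msupp_eq0; apply: contraTN mS => /gS.
Qed.

End Primes.

(** * Stable sets of a clutter *)

Section StableSets.
Variables (n : nat) (C : clutter n).
Implicit Types A B S : {set 'I_n}.

Definition stable A := [forall e in edges C, ~~ (e \subset A)].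

Lemma stablePn A :
  reflect (exists2 e, e \in edges C & e \subset A) (~~ stable A).
Proof.
rewrite negb_forall_in; apply: (iffP exists_inP) => -[e eC eA]; exists e => //.
  by rewrite negbK in eA.
by rewrite negbK.
Qed.

Lemma stableS A B : A \subset B -> stable B -> stable A.
Proof.
move=> AB; apply: contraTT => /stablePn[e eC eA].
by apply/stablePn; exists e => //; apply: subset_trans AB.
Qed.

Lemma stable0 : stable set0.
Proof.
apply/forall_inP => e eC; rewrite subset0; apply: contraTneq eC => ->.
exact: edges_neq0.
Qed.

Lemma stable1 i : stable [set i] = ([set i] \notin edges C).
Proof.
apply/idP/idP => [/forall_inP si|iC].
  by apply/negP => /si; rewrite subxx.
apply/forall_inP => e eC; rewrite subset1; apply/norP; split.
  by apply: contraNneq iC => <-.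
by apply: contraTneq eC => ->; exact: edges_neq0.
Qed.

(** The combinatorial form of: the colon ideal of the edge ideal by a monomial
    with variables [A] is generated by the variables in [S]. *)
Definition isolates A S :=
  stable (A :|: ~: S) && [forall j in S, ~~ stable (j |: A)].

Lemma isolates_stable A S : isolates A S -> stable A.
Proof. by case/andP => + _; apply: stableS; apply: subsetUl. Qed.

Lemma isolates_disjoint A S j : isolates A S -> j \in A -> j \notin S.
Proof.
move=> isoA jA; apply: contraTN (isolates_stable isoA) => jS.
have /andP[_ /forall_inP/(_ j jS)] := isoA.
by rewrite (setUidPr _) // sub1set.
Qed.

Lemma isolatesU1 A S i : i \notin S -> isolates A S -> isolates (i |: A) S.
Proof.
move=> iS /andP[sAS /forall_inP dom]; apply/andP; split.
  by rewrite -setUA (setUidPr _) // sub1set !inE iS orbT.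
apply/forall_inP => j /dom; apply: contraNN; apply: stableS.
by rewrite setUS // subsetUr.
Qed.

(** A maximal stable set [B] containing [A] works: no vertex outside [B] can be
    added to it. *)
Lemma isolates_exists A : stable A ->
  exists2 B : {set 'I_n}, A \subset B & isolates B (~: B).
Proof.
move=> sA; have [B /maxsetP[sB maxB] AB] := maxset_exists sA; exists B => //.
rewrite /isolates setCK setUid sB; apply/forall_inP => j; rewrite inE => jB.
by apply: contraNN jB => /maxB/(_ (subsetUr _ _)) <-; exact: setU11.
Qed.

End StableSets.

(** * Edge ideals and their colon ideals *)

Section EdgeIdeal.
Variables (K : fieldType) (n : nat) (C : clutter n).
Local Notation I := (edge_ideal K C).
Implicit Types (m : 'X_{1..n}) (S : {set 'I_n}) (f g : {mpoly K[n]}).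

Lemma mem_edge_ideal g :
  (g \in I) = all (fun m => ~~ stable C (vars m)) (msupp g).
Proof.
apply/idP/allP => [/asboolP[c ->]|gI].
  pose Q (p : {mpoly K[n]}) := {in msupp p, forall m, ~~ stable C (vars m)}.
  apply: (big_ind Q) => [m|p q Qp Qq m|e eC m]; first by rewrite msupp0.
    by move/msuppD_le; rewrite mem_cat => /orP[/Qp|/Qq].
  rewrite -mpolyX_set (perm_mem (msuppMX _ _)) => /mapP[m' _ ->].
  by apply/stablePn; exists e; rewrite // varsD vars_set_mnm subsetUl.
rewrite [g]mpolyE big_seq; apply: ideal_span_sum => m /gI/stablePn[e eC em].
rewrite -mul_mpolyC; apply: ideal_spanM.
rewrite -(submK (set_mnm_le em)) mpolyXD; apply: ideal_spanM.
by rewrite mpolyX_set; apply: mem_ideal_span eC.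
Qed.

Lemma mem_edge_idealMX g m : (g * 'X_[m] \in I) =
  all (fun u => ~~ stable C (vars m :|: vars u)) (msupp g).
Proof.
rewrite mem_edge_ideal (perm_all _ (msuppMX _ _)) all_map.
by apply: eq_all => u /=; rewrite varsD.
Qed.

Lemma mem_edge_idealX m : ('X_[m] \in I) = ~~ stable C (vars m).
Proof. by rewrite mem_edge_ideal msuppX /= andbT. Qed.

(** A monomial [u] multiplies [m] into the ideal exactly when it involves a
    variable of [S]: one such variable already creates an edge, and without them
    [u * m] only involves vertices of the stable set [vars m :|: ~: S]. *)
Lemma colon_isolates m S :
  isolates C (vars m) S -> colon I 'X_[m] =i var_ideal S.
Proof.
case/andP => sAS /forall_inP dom g.
rewrite mem_colon mem_edge_idealMX mem_var_ideal; apply: eq_all => u /=.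
congr (~~ _).
apply/idP/idP => [st|uS]; last by apply: stableS sAS; rewrite setUS.
apply/subsetP => j ju; rewrite inE; apply: contraTN st => /dom.
by apply: contraNN; apply: stableS; rewrite setUC setUS // sub1set.
Qed.

(** Reduction from homogeneous polynomials to monomials. The variables in the
    prime [p] determine [S], and the product of all the other variables, which
    is not in [p] by primality, selects the right monomial of [f]. *)
Lemma cond_isolates d : vnumber_cond I d ->
  exists m S, mdeg m = d /\ isolates C (vars m) S.
Proof.
move=> [f [p [/dhomogP fd [[_ p1 _] p_prime _] fp]]].
pose S := [set j | 'X_j \in p].
have XSp : 'X_[set_mnm (~: S)] \notin p.
  rewrite mpolyX_set; apply: (big_ind (fun q => q \notin p)) => //.
    by move=> u v up vp; apply/negP => /p_prime; rewrite (negbTE up) (negbTE vp).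
  by move=> j; rewrite !inE.
move: XSp; rewrite -fp mem_colon mulrC mem_edge_idealMX -has_predC.
case/hasP => m mf /=.
rewrite negbK vars_set_mnm setUC => sAS.
exists m, S; split; first exact: fd.
rewrite /isolates sAS; apply/forall_inP => j; rewrite inE -fp mem_colon mulrC.
by rewrite mem_edge_idealMX varsU => /allP/(_ m mf).
Qed.

Lemma isolates_cond m S :
  isolates C (vars m) S -> vnumber_cond I (mdeg m).
Proof.
move=> isoA; exists 'X_[m], (var_ideal S); split.
- by rewrite dhomogX.
- split; [exact: var_ideal_closed | exact: var_ideal_prime |].
  by exists 'X_[m]; exact: colon_isolates.
- exact: colon_isolates.
Qed.

(** A monomial [m] is a witness for the colon ideal by [x_i] as soon as [x_i m]
    is one for the edge ideal; [m] may or may not involve [x_i]. *)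
Lemma isolates_cond_colon i m S : isolates C (i |: vars m) S ->
  vnumber_cond (colon I 'X_i) (mdeg m).
Proof.
rewrite -varsU -varsD => /colon_isolates IS.
have {}IS : colon (colon I 'X_i) 'X_[m] =i var_ideal S.
  by move=> g; rewrite -IS mpolyXD mulrC; apply: colon_colon.
exists 'X_[m], (var_ideal S); split=> //; first by rewrite dhomogX.
split; [exact: var_ideal_closed | exact: var_ideal_prime |].
by exists 'X_[m].
Qed.

Lemma cond_colon i d :
  vnumber_cond (colon I 'X_i) d -> vnumber_cond I d.+1.
Proof.
move=> [f [p [fd [p_ideal p_prime [g gp]] fp]]].
exists (f * 'X_i), p; split.
- by rewrite -addn1; apply: dhomogM => //; rewrite dhomogX /= mdeg1.
- by split => //; exists (g * 'X_i) => h; rewrite -colon_colon.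
- by move=> h; rewrite -colon_colon; apply: fp.
Qed.

Lemma edge_ideal_irrelevant :
  (forall i, [set i] \in edges C) -> I =i irrelevant_ideal K n.
Proof.
move=> all1 g; apply/idP/idP; last first.
  apply: ideal_span_sub => i _.
  by rewrite mem_edge_idealX varsU stable1 negbK.
apply: ideal_span_sub => e eC; have [x xe] : exists x, x \in e.
  by apply/set0Pn; apply: contraTneq eC => ->; exact: edges_neq0.
rewrite (bigD1 x) //= mulrC; apply: ideal_spanM.
exact: mem_ideal_span (in_setT x).
Qed.

End EdgeIdeal.

(** * Attaining the v-number *)

Section VNumberTheory.
Variables (K : fieldType) (n : nat).
Implicit Type I : {pred {mpoly K[n]}}.

Lemma vnumber_le I d : vnumber_cond I d -> (vnumber I <= d)%N.
Proof.
move=> Id; rewrite /vnumber; case: pselect => // exd.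
by case: ex_minnP => v _; apply; apply/asboolP.
Qed.

Lemma vnumberP I d : vnumber_cond I d -> vnumber_cond I (vnumber I).
Proof.
move=> Id; rewrite /vnumber; case: pselect => [exd|]; last first.
  by case; exists d; apply/asboolP.
by case: ex_minnP => v /asboolP.
Qed.

Lemma vnumber_isolates (C : clutter n) : exists (m : 'X_{1..n}) S,
  mdeg m = vnumber (edge_ideal K C) /\ isolates C (vars m) S.
Proof.
have [B _ isoB] := isolates_exists (stable0 C).
apply: cond_isolates; apply: (@vnumberP _ (mdeg (set_mnm B))).
by apply: (@isolates_cond _ _ _ _ (~: B)); rewrite vars_set_mnm.
Qed.

End VNumberTheory.

(** * Deletion of a vertex *)

Section Deletion.
Variables (n : nat) (C : clutter n) (i : 'I_n).
Implicit Types (A S : {set 'I_n}) (B : {set 'I_n.-1}).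

Lemma stable_del B : stable (clutter_del C i) B = stable C (lift i @: B).
Proof.
apply: negb_inj; apply/stablePn/stablePn => -[e].
  case/imsetP => f; rewrite inE => /andP[fC fi] -> fB; exists f => //.
  apply/subsetP => x xf; case: (unliftP i x) => [y Dx|Dx]; last first.
    by rewrite -Dx xf in fi.
  by rewrite Dx imset_f // (subsetP fB) // inE -Dx.
move=> eC /subsetP eB; have ie : i \notin e.
  by apply/negP => /eB/imsetP[y _ /eqP]; rewrite (negbTE (neq_lift i y)).
exists (lift i @^-1: e); first by apply: imset_f; rewrite inE eC.
by apply/subsetP => y; rewrite inE => /eB; rewrite mem_imset //; exact: lift_inj.
Qed.

Lemma lift_preimset_sub A : lift i @: (lift i @^-1: A) \subset A.
Proof. by apply/subsetP => _ /imsetP[y + ->]; rewrite inE. Qed.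

Lemma lift_preimset A : i \notin A -> lift i @: (lift i @^-1: A) = A.
Proof.
move=> iA; apply/eqP; rewrite eqEsubset lift_preimset_sub.
apply/subsetP => x xA; case: (unliftP i x) => [y Dx|Dx]; last first.
  by rewrite -Dx xA in iA.
by rewrite Dx imset_f // inE -Dx.
Qed.

(** The edges that witness instability of [j |: A] for [j != i] avoid [i], hence
    survive the deletion; deleting edges keeps stable sets stable. *)
Lemma isolates_del A S : i \notin A -> isolates C A S ->
  isolates (clutter_del C i) (lift i @^-1: A) (lift i @^-1: S).
Proof.
move=> iA /andP[sAS /forall_inP dom]; apply/andP; split.
  rewrite stable_del; apply: stableS sAS.
  by rewrite -preimsetC -preimsetU lift_preimset_sub.
apply/forall_inP => j; rewrite inE => /dom.
by rewrite stable_del imsetU1 lift_preimset.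
Qed.

(** The monomial obtained by setting [x_i] to 1. *)
Definition restrict_mnm (m : 'X_{1..n}) : 'X_{1..n.-1} :=
  [multinom m (lift i j) | j < n.-1].

Lemma vars_restrict m : vars (restrict_mnm m) = lift i @^-1: vars m.
Proof. by apply/setP => j; rewrite !inE mnmE. Qed.

Lemma mdeg_restrict m : (mdeg (restrict_mnm m) <= mdeg m)%N.
Proof.
rewrite !mdegE (bigD1_ord i) //=; apply: leq_trans (leq_addl _ _).
by apply: leq_sum => j _; rewrite mnmE.
Qed.

End Deletion.

(** * The v-number under colon and deletion *)

Theorem proposition3p13 (K : fieldType) (n : nat) (n_ge1 : (1 <= n)%N)
    (C : clutter n) (I := edge_ideal K C) :
  [/\ (forall i : 'I_n, [set i] \notin edges C ->
         (vnumber I <= vnumber (colon I 'X_i) + 1)%N),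
      (~ (I =i irrelevant_ideal K n) ->
         exists i : 'I_n, 1 \notin colon I 'X_i /\
           (vnumber (colon I 'X_i) <= vnumber I)%N),
      ((2 <= vnumber I)%N ->
         exists i : 'I_n, 1 \notin colon I 'X_i /\
           (vnumber (colon I 'X_i) < vnumber I)%N) &
      (exists i : 'I_n,
         (vnumber (edge_ideal K (clutter_del C i)) <= vnumber I)%N)].
Proof.
have [m [S [mI isoA]]] := vnumber_isolates K C.
have proper i A : isolates C (i |: A) S -> 1 \notin colon I 'X_i.
  move=> /isolates_stable st; rewrite mem_colon mul1r.
  rewrite mem_edge_idealX varsU negbK.
  by apply: stableS st; exact: subsetUl.
split.
- move=> i; rewrite -stable1 => /isolates_exists[B iB isoB].
  rewrite addn1; apply/vnumber_le/cond_colon/vnumberP.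
  apply: (isolates_cond_colon K (m := set_mnm B) (S := ~: B)).
  by rewrite vars_set_mnm (setUidPr iB).
- move=> I_neq; have [/forallP ST|] := boolP [forall i, i \in S].
    (* A set that isolates all vertices contains none of them. *)
    case: I_neq; apply: edge_ideal_irrelevant => i.
    have A0 : vars m = set0.
      apply/setP => j; rewrite [RHS]inE; apply/negP => /(isolates_disjoint isoA).
      by rewrite ST.
    have /andP[_ /forall_inP/(_ i (ST i))] := isoA.
    by rewrite A0 setU0 stable1 negbK.
  case/forallPn => i iS; exists i; have isoi := isolatesU1 iS isoA.
  split; first exact: proper isoi.
  by rewrite -mI; apply: vnumber_le; exact: isolates_cond_colon isoi.
- move=> v2; have [i im] : exists i, i \in vars m.
    apply/existsP; apply: contraLR v2 => /existsPn m0.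
    rewrite -mI (_ : m = 0%MM) ?mdeg0 //; apply/mnmP => i; rewrite mnm0E.
    by have := m0 i; rewrite inE negbK => /eqP.
  have Ui : (U_(i) <= m)%MM.
    apply/mnm_lepP => j; rewrite mnm1E; case: eqP => //= <-.
    by move: im; rewrite inE lt0n.
  have Dm : (U_(i) + (m - U_(i)))%MM = m by rewrite addmC submK.
  have isoi : isolates C (i |: vars (m - U_(i))) S by rewrite -varsU -varsD Dm.
  exists i; split; first exact: proper isoi.
  rewrite -mI -Dm mdegD mdeg1 ltnS.
  by apply: vnumber_le; exact: isolates_cond_colon isoi.
- have [/forallP AT|/forallPn[i iA]] := boolP [forall i, i \in vars m].
    (* Every vertex is in a stable set, so there is no edge: the constant 1
       isolates the empty set. *)
    pose i := Ordinal n_ge1; exists i; apply: leq_trans (leq0n _).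
    rewrite -(@mdeg0 n.-1); apply/vnumber_le/(@isolates_cond _ _ _ _ set0).
    apply/andP; split; last by apply/forall_inP => j; rewrite inE.
    rewrite stable_del; apply: stableS (isolates_stable isoA).
    by apply/subsetP => j _; exact: AT.
  exists i; rewrite -mI; apply: leq_trans (mdeg_restrict i m); apply: vnumber_le.
  apply: (@isolates_cond _ _ _ _ (lift i @^-1: S)).
  by rewrite vars_restrict; exact: isolates_del.
Qed.
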